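(* The computational complexity of the anchor net method (described in the context), applied to a dataset $X=\{x_1,\dots,x_n\}\subset\mathbb{R}^d$ with net size $m$, is $O(mdn)$.
   Context: A low discrepancy set in a box is a point set from a standard family (Halton sequences, digital nets, tensor grids, etc.), rescaled to the box; generating such a set with $k$ points in a box in $\mathbb{R}^d$ costs $O(dk)$ operations. Complexity counts arithmetic operations and comparisons. $\lambda$ denotes Lebesgue measure, $\#$ cardinality, $\lceil\cdot\rceil$ the ceiling function. Anchor net construction. Input: $X=\{x_1,\dots,x_n\}\subset\mathbb{R}^d$ and net size $m$ (a positive integer). (1) Create a low discrepancy set $\mathcal T=\{t_1,\dots,t_s\}$ with $s=O(m)$ points in the smallest rectangular (axis-parallel) box $B_0$ that contains $X$. (2) Initialize $G_i=\emptyset$ for $i=1,\dots,s$. For $j=1,\dots,n$: find an index $i$ minimizing $\|x_j-t_k\|_\infty$ over $k=1,\dots,s$ and update $G_i=G_i\cup\{x_j\}$. (3) Keep the nonempty sets, relabelled $G_1,\dots,G_Q$. For $i=1,\dots,Q$, find the smallest closed axis-parallel box $B_i$ that contains $G_i$ and compute $\lambda(B_i)$ (it is assumed that $\sum_{i}\lambda(B_i)>0$ so that the next step is meaningful). (4) Choose low discrepancy sets $\mathcal A^{(i)}\subset B_i$, $i=1,\dots,Q$, with $\#\mathcal A^{(i)}=\lceil m\,\lambda(B_i)/\sum_{k=1}^Q\lambda(B_k)\rceil$. (5) Return the anchor net $\mathcal A_X=\bigcup_{i=1}^Q\mathcal A^{(i)}$. Anchor net method. Input: $X$ and $m$. First apply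 the anchor net construction with net size $m$ to obtain $\mathcal A_X$. Start with $S=\emptyset$. For each $y\in\mathcal A_X$: find $x_i\in X$ minimizing $\|x_k-y\|_\infty$ over $x_k\in X$ and update $S=S\cup\{x_i\}$. Return the set $S$ of landmark points. *)

(* Defs.v *)
From HB Require Import structures.
From mathcomp Require Import all_boot all_order all_algebra.
From mathcomp Require Import reals topology normedtype.

Set Implicit Arguments.
Unset Strict Implicit.
Unset Printing Implicit Defensive.

Import Order.TTheory GRing.Theory Num.Theory numFieldNormedType.Exports.

Local Open Scope ring_scope.

(* Complexity is measured in the real-RAM model: a computation carries, besides
   its result, the number of arithmetic operations and comparisons performed.
   Only the primitives below ([add_op], ..., [empty_op]) have a positive cost;
   everything else ([ret], [bind] and the loops) merely propagates costs. *)
Record counted (A : Type) := Counted { result : A; cost : nat }.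

Definition ret A (a : A) : counted A := Counted a 0.

Definition bind A B (c : counted A) (f : A -> counted B) : counted B :=
  Counted (result (f (result c))) (cost c + cost (f (result c))).

Notation "'let*' x ':=' c 'in' f" := (bind c (fun x => f))
  (at level 200, x name, c at level 200, f at level 200,
   format "'[v' 'let*'  x  ':='  c  'in' '/' f ']'").

Fixpoint mapM A B (f : A -> counted B) (s : seq A) : counted (seq B) :=
  if s is a :: s' then
    let* b := f a in
    let* bs := mapM f s' in
    ret (b :: bs)
  else ret [::].

Fixpoint foldM A B (f : B -> A -> counted B) (b : B) (s : seq A) : counted B :=
  if s is a :: s' then
    let* b' := f b a in
    foldM f b' s'
  else ret b.

Fixpoint filterM A (p : A -> counted bool) (s : seq A) : counted (seq A) :=
  if s is a :: s' then
    let* b := p a in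
    let* s'' := filterM p s' in
    ret (if b then a :: s'' else s'')
  else ret [::].

Section Primitives.
Variable R : realType.
Implicit Types x y : R.

Definition add_op x y : counted R := Counted (x + y) 1.
Definition sub_op x y : counted R := Counted (x - y) 1.
Definition mul_op x y : counted R := Counted (x * y) 1.
Definition div_op x y : counted R := Counted (x / y) 1.
Definition opp_op x : counted R := Counted (- x) 1.
Definition lt_op x y : counted bool := Counted (x < y) 1.
(* For [0 <= x], the only use made of it, this is the ceiling of [x] as a
   natural number. *)
Definition ceil_op x : counted nat := Counted `|Num.ceil x|%N 1.
Definition empty_op A (s : seq A) : counted bool := Counted (nilp s) 1.

Definition abs_op x : counted R :=
  let* b := lt_op x 0 in
  if b then opp_op x else ret x.

Definition max_op x y : counted R :=
  let* b := lt_op x y in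
  ret (if b then y else x).

Definition min_op x y : counted R :=
  let* b := lt_op x y in
  ret (if b then x else y).

End Primitives.

Section AnchorNet.
Variables (R : realType) (d : nat).

Definition pt := 'rV[R]_d.

(* [(a, b)] stands for the closed axis-parallel box of all [x] with
   [a 0 j <= x 0 j <= b 0 j] for every [j]. *)
Definition box := (pt * pt)%type.

Definition in_box (B : box) (x : pt) : bool :=
  [forall j, B.1 0 j <= x 0 j <= B.2 0 j].

(* The Lebesgue measure of a nonempty box. *)
Definition box_measure (B : box) : R := \prod_(j < d) (B.2 0 j - B.1 0 j).

(* The vector with coordinates [f j], computed coordinate by coordinate. *)
Definition pointM (f : 'I_d -> counted R) : counted pt :=
  Counted (\row_j result (f j)) (\sum_j cost (f j)).

Definition linf_dist (x y : pt) : counted R :=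
  foldM (fun acc j =>
           let* t := sub_op (x 0 j) (y 0 j) in
           let* a := abs_op t in
           max_op acc a)
        0 (enum 'I_d).

Definition box_volume (B : box) : counted R :=
  foldM (fun acc j =>
           let* w := sub_op (B.2 0 j) (B.1 0 j) in
           mul_op acc w)
        1 (enum 'I_d).

(* The smallest box containing a nonempty list of points; on the empty list, on
   which it is not used, the value is arbitrary. *)
Definition bounding_box (s : seq pt) : counted box :=
  if s is x :: s' then
    foldM (fun (B : box) (y : pt) =>
             let* a := pointM (fun j => min_op (B.1 0 j) (y 0 j)) in
             let* b := pointM (fun j => max_op (B.2 0 j) (y 0 j)) in
             ret (a, b))
          (x, x) s'
  else ret (0, 0).

(* [nearest y s] is the first index [k] minimizing the sup-norm distance of [y]
   to [s`_k]; in [nearest_from], [best] is the best index among those below [k],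
   and [r] the corresponding distance. *)
Fixpoint nearest_from (y : pt) (best : nat) (r : R) (k : nat)
    (s : seq pt) : counted nat :=
  if s is t :: s' then
    let* r' := linf_dist y t in
    let* b := lt_op r' r in
    if b then nearest_from y k r' k.+1 s' else nearest_from y best r k.+1 s'
  else ret best.

Definition nearest (y : pt) (s : seq pt) : counted nat :=
  if s is t :: s' then
    let* r := linf_dist y t in
    nearest_from y 0 r 1 s'
  else ret 0%N.

(* A family of point sets in the unit cube (Halton, digital net, tensor grid,
   etc.): [U k] generates the set of the family that has [k] points. Being of
   low discrepancy has no bearing on the complexity, hence does not occur. *)
Definition point_family := nat -> counted (seq pt).

Definition is_point_family (U : point_family) : Prop :=
  forall k, [/\ size (result (U k)) = k, uniq (result (U k)) &
                all (in_box (0, const_mx 1)) (result (U k))].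

(* The [k]-point set of the family [U], rescaled to the box [B]. *)
Definition rescaled_set (U : point_family) (k : nat) (B : box) :
    counted (seq pt) :=
  let* us := U k in
  mapM (fun u : pt =>
          pointM (fun j =>
            let* w := sub_op (B.2 0 j) (B.1 0 j) in
            let* v := mul_op w (u 0 j) in
            add_op (B.1 0 j) v))
       us.

(* In the following, [F] gives the family used at each place where a low
   discrepancy set is called for: [F 0] for the initial set [T] in the bounding
   box of [X], and [F i], with [i = 1, ..., Q], for the set [A^(i)] in the box
   [B_i] of the [i]-th nonempty group. *)

Definition initial_set (F : nat -> point_family) (s : nat) (X : seq pt) :
    counted (seq pt) :=
  let* B0 := bounding_box X in
  rescaled_set (F 0%N) s B0.

(* [x] joins the group of the point of [T] nearest to it; since [X] is free of
   duplicates, adding [x] to a group needs no membership test. The empty groups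
   are then removed, at the cost of one comparison per group. *)
Definition groups (T X : seq pt) : counted (seq (seq pt)) :=
  let* G := foldM (fun G x =>
                     let* i := nearest x T in
                     ret (set_nth [::] G i (rcons (nth [::] G i) x)))
                  (nseq (size T) [::]) X in
  filterM (fun g => let* b := empty_op g in ret (~~ b)) G.

Definition anchor_boxes (F : nat -> point_family) (s : nat) (X : seq pt) :
    counted (seq box) :=
  let* T := initial_set F s X in
  let* Gs := groups T X in
  mapM bounding_box Gs.

(* The union of the sets [A^(i)] is the concatenation of the lists: a point that
   belongs to several of them is listed (and later processed) several times. *)
Definition anchor_net (F : nat -> point_family) (s m : nat) (X : seq pt) :
    counted (seq pt) :=
  let* Bs := anchor_boxes F s X in
  let* vols := mapM box_volume Bs in
  let* total := foldM (@add_op R) 0 vols in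
  let* As := mapM (fun p : nat * (box * R) =>
                     let: (i, (B, v)) := p in
                     let* w := mul_op m%:R v in
                     let* q := div_op w total in
                     let* k := ceil_op q in
                     rescaled_set (F i) k B)
                  (zip (iota 1 (size Bs)) (zip Bs vols)) in
  ret (flatten As).

(* The subset [S] of [X] is represented by its characteristic vector. *)
Definition anchor_net_method (F : nat -> point_family) (s m : nat)
    (X : seq pt) : counted (seq pt) :=
  let* A := anchor_net F s m X in
  let* S := foldM (fun S y =>
                     let* i := nearest y X in
                     ret (set_nth false S i true))
                  (nseq (size X) false) A in
  ret (mask S X).

End AnchorNet.

Section Correctness.
Variables (R : realType) (d : nat).
Lemma result_foldM A B (f : B -> A -> counted B) b s :
  result (foldM f b s) = foldl (fun b a => result (f b a)) b s.
Proof. by elim: s b => //= a s IHs b; rewrite IHs. Qed.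

Lemma result_min_op (x y : R) : result (min_op x y) = Num.min x y.
Proof. by []. Qed.
Lemma result_max_op (x y : R) : result (max_op x y) = Num.max x y.
Proof. by []. Qed.
Lemma result_abs_op (x : R) : result (abs_op x) = `|x|.
Proof. by rewrite /abs_op /=; case: ltrP => h /=; [rewrite ltr0_norm|rewrite ger0_norm]. Qed.

(* [`|_|] is the sup norm on ['rV[R]_d]. *)
Lemma linf_distE (x y : pt R d) : result (linf_dist x y) = `|x - y|.
Proof.
rewrite /linf_dist result_foldM [RHS]mx_normrE.
set g := fun j => `|x 0 j - y 0 j|.
have E (b : R) s : foldl (fun b j => result (let* t := sub_op (x 0 j) (y 0 j) in
                   let* a := abs_op t in max_op b a)) b s = foldl (fun b j => Num.max b (g j)) b s.
  by elim: s b => //= j s IHs b; rewrite -IHs /= result_abs_op.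
rewrite {}E; apply/eqP; rewrite eq_le; apply/andP; split.
- have H s (b c : R) : b <= c -> (forall j, g j <= c) -> foldl (fun b j => Num.max b (g j)) b s <= c.
    elim: s b => //= j s IHs b bc gc; apply: IHs => //.
    by rewrite ge_max bc gc.
  apply: H => [|j].
    by apply: bigmax_ge_id.
  have := @le_bigmax _ R _ 0 (fun i : 'I_1 * 'I_d => `|(x - y) i.1 i.2|) (0, j).
  by rewrite /= !mxE.
- have H s (b : R) : b <= foldl (fun b j => Num.max b (g j)) b s /\
       forall j, j \in s -> g j <= foldl (fun b j => Num.max b (g j)) b s.
    elim: s b => //= j s IHs b.
    have [h1 h2] := IHs (Num.max b (g j)); split.
      by apply: le_trans h1; rewrite le_max lexx.
    move=> k; rewrite inE => /orP[/eqP->|/h2 //].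
    by apply: le_trans h1; rewrite le_max lexx orbT.
  have [h1 h2] := H (enum 'I_d) 0.
  apply/bigmax_leP; split => // -[i j] _ /=.
  by rewrite !mxE ord1; apply: h2; rewrite mem_enum.
Qed.

Lemma box_volumeE (B : box R d) : result (box_volume B) = box_measure B.
Proof.
rewrite /box_volume result_foldM /box_measure -big_enum /=.
have H s (b : R) : foldl (fun b j => result (let* w := sub_op (B.2 0 j) (B.1 0 j) in mul_op b w)) b s
   = b * \prod_(j <- s) (B.2 0 j - B.1 0 j).
  elim: s b => /= [b|j s IHs b]; first by rewrite big_nil mulr1.
  by rewrite IHs big_cons mulrA.
by rewrite H mul1r.
Qed.

Lemma nearestP (y : pt R d) s t : t \in s ->
  (result (nearest y s) < size s)%N /\
  `|y - nth 0 s (result (nearest y s))| <= `|y - t|.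
Proof.
have H s' : forall s0 best, (best < size s0)%N ->
   (forall t, t \in s0 -> `|y - nth 0 s0 best| <= `|y - t|) ->
   let i := result (nearest_from y best `|y - nth 0 s0 best| (size s0) s') in
   (i < size (s0 ++ s'))%N /\
   forall t, t \in s0 ++ s' -> `|y - nth 0 (s0 ++ s') i| <= `|y - t|.
  elim: s' => [|u s' IHs] s0 best lb hb /=; first by rewrite cats0.
  rewrite linf_distE -cat_rcons.
  have Eu : nth 0 (rcons s0 u) (size s0) = u by rewrite nth_rcons ltnn eqxx.
  have Eb : nth 0 (rcons s0 u) best = nth 0 s0 best by rewrite nth_rcons lb.
  case: ltP => h /=.
  - have /= := IHs (rcons s0 u) (size s0).
    rewrite Eu size_rcons; apply=> // t'.
    rewrite mem_rcons inE => /orP[/eqP->//|/hb]; apply: le_trans; exact: ltW.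
  - have /= := IHs (rcons s0 u) best.
    rewrite Eb size_rcons; apply=> [|t']; first exact: ltnW.
    by rewrite mem_rcons inE => /orP[/eqP->//|/hb].
case: s => // u s ts; rewrite /nearest /= linf_distE.
have /= [//|t'|h1 h2] := H s [:: u] 0%N.
  by rewrite inE => /eqP->.
by split; last exact: h2.
Qed.

Lemma bounding_boxP (s : seq (pt R d)) : s != [::] ->
  all (in_box (result (bounding_box s))) s /\
  forall B, all (in_box B) s ->
    forall x, in_box (result (bounding_box s)) x -> in_box B x.
Proof.
case: s => // x s _; rewrite /= result_foldM.
set f := fun B y => result _.
have H s' : forall s0 (C : box R d), all (in_box C) s0 ->
  (forall B, all (in_box B) s0 -> forall z, in_box C z -> in_box B z) ->
  (forall B, all (in_box B) s0 -> in_box B C.1 && in_box B C.2) ->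
  let D := foldl f C s' in
  all (in_box D) (s0 ++ s') /\
  forall B, all (in_box B) (s0 ++ s') -> in_box B D.1 && in_box B D.2.
  elim: s' => [|y s' IHs] s0 C h1 h2 h3 /=; first by rewrite cats0.
  have fE : f C y = (\row_j Num.min (C.1 0 j) (y 0 j), \row_j Num.max (C.2 0 j) (y 0 j)).
    by [].
  have fe z : in_box C z -> in_box (f C y) z.
    move=> /forallP hz; apply/forallP => j; have /andP[a b] := hz j.
    by rewrite fE /= !mxE ge_min a le_max b.
  rewrite -cat_rcons; apply: IHs.
  - rewrite all_rcons; apply/andP; split.
      by apply/forallP => j; rewrite fE /= !mxE ge_min lexx le_max lexx !orbT.
    by apply: sub_all h1.
  - move=> B; rewrite all_rcons => /andP[By Bs] z /forallP Dz.
    have /andP[/forallP B1 /forallP B2] := h3 B Bs.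
    apply/forallP => j; have := Dz j; rewrite fE /= !mxE => /andP[a b].
    move/forallP/(_ j): By => /andP[c e].
    have /andP[p q] := B1 j; have /andP[p' q'] := B2 j.
    apply/andP; split.
      by apply: le_trans a; rewrite le_min p c.
    by apply: le_trans b _; rewrite ge_max q' e.
  - move=> B; rewrite all_rcons => /andP[By Bs].
    have /andP[/forallP B1 /forallP B2] := h3 B Bs.
    move/forallP: By => By.
    apply/andP; split; apply/forallP => j; rewrite fE /= !mxE;
    have /andP[p q] := B1 j; have /andP[p' q'] := B2 j; have /andP[c e] := By j.
      by rewrite le_min p c /= ge_min q.
    by rewrite le_max p' /= ge_max q' e.
have [|||h1 h2] := H s [:: x] (x, x).
- by rewrite /= andbT; apply/forallP => j; rewrite /= lexx.
- move=> B /=; rewrite andbT => /forallP Bx z /forallP hz; apply/forallP => j.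
  have /andP[a b] := hz j; have /andP[a' b'] := Bx j.
  by rewrite (le_trans a' a) (le_trans b b').
- by move=> B /=; rewrite andbT => ->.
split => // B hB z /forallP hz; have /andP[/forallP p /forallP q] := h2 B hB.
apply/forallP => j; have /andP[a b] := hz j.
have /andP[a' _] := p j; have /andP[_ b'] := q j.
by rewrite (le_trans a' a) (le_trans b b').
Qed.
End Correctness.

(* Main.v *)
Require Import Defs.
From mathcomp Require Import all_boot all_order all_algebra.
From mathcomp Require Import reals.
From mathcomp Require Import zify.

(** Every loop of the method costs a bounded number of operations per coordinate
    that it visits, so the cost is bounded once the number of points on which
    each loop runs is known. A nearest point search among [k] points costs at
    most [(4 d + 1) k] operations and a bounding box of [k] points at most
    [2 d k]. Hence assigning the [n] points to the [s] points of the initial set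
    costs [O(d n s)]. The groups so obtained are at most [s] in number and share
    the [n] points among them, so that all their bounding boxes together cost
    [O(d n)] and the volumes of these boxes [O(d s)].

    What remains is the size of the anchor net. Each volume is nonnegative, and
    the ceiling of [m v / total] is at most [m v / total + 1]; summing over the
    at most [s] boxes, the net has at most [m + s] points
    ([sum_ceil_share_le], [anchor_net_bounds]). The last loop therefore costs
    [O((m + s) d n)], and [s <= c_s * m] gives the bound. Positivity of the total
    volume is used to divide by it, and it also forces [n] to be positive, so
    that terms such as [d s], in which [n] is missing, are bounded by a multiple
    of [m d n]. *)

Local Open Scope ring_scope.

Set Implicit Arguments.
Unset Strict Implicit.
Unset Printing Implicit Defensive.

Import Order.TTheory GRing.Theory Num.Theory.

(** * Cost and result of the loops *)

Section Loops.
Variables A B : Type.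
Implicit Types (s : seq A).

Lemma cost_mapM (f : A -> counted B) s :
  cost (mapM f s) = (\sum_(a <- s) cost (f a))%N.
Proof.
elim: s => [|a s IHs] /=; first by rewrite big_nil.
by rewrite big_cons IHs addn0.
Qed.

Lemma result_mapM (f : A -> counted B) s :
  result (mapM f s) = [seq result (f a) | a <- s].
Proof. by elim: s => //= a s ->. Qed.

Lemma cost_filterM (p : A -> counted bool) s :
  cost (filterM p s) = (\sum_(a <- s) cost (p a))%N.
Proof.
elim: s => [|a s IHs] /=; first by rewrite big_nil.
by rewrite big_cons IHs addn0.
Qed.

Lemma result_filterM (p : A -> counted bool) s :
  result (filterM p s) = [seq a <- s | result (p a)].
Proof. by elim: s => //= a s ->. Qed.

Lemma cost_foldM_le K (f : B -> A -> counted B) b s :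
  (forall b a, (cost (f b a) <= K)%N) -> (cost (foldM f b s) <= K * size s)%N.
Proof.
move=> fK; elim: s b => //= a s IHs b.
by rewrite mulnS leq_add.
Qed.

End Loops.

Lemma cost_bind A B (c : counted A) (f : A -> counted B) :
  cost (bind c f) = (cost c + cost (f (result c)))%N.
Proof. by []. Qed.

Lemma result_bind A B (c : counted A) (f : A -> counted B) :
  result (bind c f) = result (f (result c)).
Proof. by []. Qed.

(** * Cost of the geometric subroutines *)

Section Geometry.
Variables (R : realType) (d : nat).
Implicit Types (x y : pt R d) (s : seq (pt R d)) (B : box R d).

Lemma cost_abs_op (x : R) : (cost (abs_op x) <= 2)%N.
Proof. by rewrite /abs_op /=; case: (x < 0). Qed.

Lemma cost_linf_dist x y : (cost (linf_dist x y) <= 4 * d)%N.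
Proof.
rewrite -[d in leqRHS]size_enum_ord; apply: cost_foldM_le => acc j.
have := cost_abs_op (x 0 j - y 0 j).
by rewrite !cost_bind /=; lia.
Qed.

Lemma cost_box_volume B : (cost (box_volume B) <= 2 * d)%N.
Proof. by rewrite -[d in leqRHS]size_enum_ord; apply: cost_foldM_le. Qed.

Lemma cost_bounding_box s : (cost (bounding_box s) <= 2 * d * size s)%N.
Proof.
case: s => // x s; rewrite mulnS.
apply: leq_trans (leq_addl _ _); apply: cost_foldM_le => B y.
rewrite /= !sum_nat_const card_ord; lia.
Qed.

Lemma cost_nearest_from y best r k s :
  (cost (nearest_from y best r k s) <= (4 * d + 1) * size s)%N.
Proof.
elim: s best r k => //= t s IHs best r k.
have := cost_linf_dist y t.
have := IHs best r k.+1; have := IHs k (result (linf_dist y t)) k.+1.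
by case: ltP => _; lia.
Qed.

Lemma cost_nearest y s : (cost (nearest y s) <= (4 * d + 1) * size s)%N.
Proof.
case: s => //= t s.
have := cost_linf_dist y t.
have := cost_nearest_from y 0 (result (linf_dist y t)) 1 s.
lia.
Qed.

(** On the empty list the box is degenerate, and the bound still holds. *)
Lemma box_measure_bounding_box_ge0 s :
  0 <= box_measure (result (bounding_box s)).
Proof.
case: s => [|x s]; first by apply: prodr_ge0 => j _; rewrite /= mxE subrr.
have [/= /andP[/forallP inx _] _] := @bounding_boxP R d (x :: s) isT.
apply: prodr_ge0 => j _; have /andP[lx xu] := inx j.
by rewrite subr_ge0 (le_trans lx xu).
Qed.

Lemma size_rescaled_set (U : point_family R d) k B :
  is_point_family U -> size (result (rescaled_set U k B)) = k.
Proof. by move=> /(_ k)[sU _ _]; rewrite result_bind result_mapM size_map. Qed.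

End Geometry.

(** * Distribution of the points into groups *)

Section Groups.
Variables (R : realType) (d : nat) (T : seq (pt R d)).
Implicit Types (X : seq (pt R d)).

Lemma sumn_shape_set_nth_rcons A (G : seq (seq A)) i x :
  sumn (shape (set_nth [::] G i (rcons (nth [::] G i) x))) = (sumn (shape G)).+1.
Proof.
elim: G i => [|g G IHG] [|i] /=.
- by [].
- by elim: i.
- by rewrite size_rcons.
- by rewrite IHG addnS.
Qed.

Lemma sumn_shape_filter A (p : pred (seq A)) (G : seq (seq A)) :
  (sumn (shape (filter p G)) <= sumn (shape G))%N.
Proof. by elim: G => //= g G; case: (p g) => /=; lia. Qed.

(** When [T] is nonempty, the search never leads outside the initial list of
    groups, which thus keeps one group per point of [T]. *)
Lemma groups_bounds X : (0 < size T)%N ->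
  [/\ (cost (groups T X) <= (4 * d + 1) * size T * size X + size T)%N,
      (size (result (groups T X)) <= size T)%N &
      (sumn (shape (result (groups T X))) <= size X)%N].
Proof.
move=> T_gt0; rewrite /groups.
set step := fun G x => bind (nearest x T) _.
set G := foldM step _ X.
have cost_step H x : (cost (step H x) <= (4 * d + 1) * size T)%N.
  by rewrite cost_bind addn0 cost_nearest.
have [sizeG shapeG] : size (result G) = size T /\ sumn (shape (result G)) = size X.
  have inv H : size H = size T ->
      size (result (foldM step H X)) = size T /\
      sumn (shape (result (foldM step H X))) = (sumn (shape H) + size X)%N.
    elim: X H {G} => [|x X IHX] H sizeH /=; first by rewrite addn0.
    have /IHX[-> ->] : size (result (step H x)) = size T.
      rewrite result_bind /= size_set_nth sizeH; apply/maxn_idPr.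
      by have [] := @nearestP R d x T (nth 0 T 0) (mem_nth _ T_gt0).
    by split=> //; rewrite result_bind /= sumn_shape_set_nth_rcons addSnnS.
  have [-> ->] := inv (nseq (size T) [::]) (size_nseq _ _).
  by split=> //; rewrite /shape map_nseq sumn_nseq.
rewrite cost_bind result_bind cost_filterM result_filterM; split.
- apply: leq_add; first exact: cost_foldM_le.
  by rewrite -sizeG /= sum1_size.
- by rewrite -sizeG size_filter count_size.
- by rewrite -shapeG sumn_shape_filter.
Qed.

Lemma groups_nil : result (groups T [::]) = [::].
Proof. by rewrite /groups result_bind result_filterM /=; elim: (size T). Qed.

End Groups.

(** * Size and cost of the anchor net *)

Lemma natr_ceil_le (R : realType) (x : R) :
  0 <= x -> (`|Num.ceil x|%N)%:R <= x + 1.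
Proof.
move=> x_ge0; rewrite natr_absz ger0_norm; last first.
  by rewrite ceil_ge0 (lt_le_trans _ x_ge0) // ltrN10.
by rewrite -lerBlDr -(intrD _ _ (-1)) ltW // ceilB1_lt.
Qed.

(** Rounding up the shares of [m] proportional to the weights [v] adds at most
    one unit per weight. *)
Lemma sum_ceil_share_le (R : realType) (m : nat) (vs : seq R) :
  all (fun v => 0 <= v) vs -> 0 < \sum_(v <- vs) v ->
  (\sum_(v <- vs) `|Num.ceil (m%:R * v / \sum_(w <- vs) w)|
     <= m + size vs)%N.
Proof.
set total := \sum_(w <- vs) w => /allP vs_ge0 total_gt0.
rewrite -(ler_nat R) natr_sum.
have -> : (m + size vs)%:R = \sum_(v <- vs) (m%:R * v / total + 1) :> R.
  rewrite big_split /= -mulr_suml -mulr_sumr -/total mulfK ?gt_eqF//.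
  by rewrite natrD -sum1_size natr_sum.
rewrite big_seq [leRHS]big_seq; apply: ler_sum => v /vs_ge0 v_ge0.
by apply: natr_ceil_le; rewrite divr_ge0 ?mulr_ge0// ltW.
Qed.

Section AnchorNet.
Variables (R : realType) (d c_F : nat) (F : nat -> point_family R d).
Hypothesis F_family : forall i, is_point_family (F i).
Hypothesis F_cost :
  forall i k B, (cost (rescaled_set (F i) k B) <= c_F * (d * k))%N.
Variables (s : nat) (X : seq (pt R d)).
Hypothesis s_gt0 : (0 < s)%N.

Lemma cost_initial_set :
  (cost (initial_set F s X) <= 2 * d * size X + c_F * (d * s))%N.
Proof. by rewrite cost_bind leq_add ?cost_bounding_box. Qed.

Lemma size_initial_set : size (result (initial_set F s X)) = s.
Proof. by rewrite result_bind size_rescaled_set. Qed.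

Lemma anchor_boxes_bounds :
  (cost (anchor_boxes F s X) <=
     4 * d * size X + c_F * (d * s) + (4 * d + 1) * s * size X + s)%N /\
  (size (result (anchor_boxes F s X)) <= s)%N.
Proof.
have := @groups_bounds R d (result (initial_set F s X)) X.
rewrite size_initial_set => /(_ s_gt0)[costG sizeG shapeG].
rewrite /anchor_boxes 2!cost_bind 2!result_bind; split; last first.
  by rewrite result_mapM size_map.
have costB : (cost (mapM (@bounding_box R d)
    (result (groups (result (initial_set F s X)) X))) <= 2 * d * size X)%N.
  rewrite cost_mapM.
  apply: leq_trans (leq_mul (leqnn (2 * d)) shapeG).
  rewrite sumnE big_map big_distrr /=.
  by apply: leq_sum => g _; apply: cost_bounding_box.
have := cost_initial_set; lia.
Qed.

Lemma anchor_boxes_measure_ge0 B :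
  B \in result (anchor_boxes F s X) -> 0 <= box_measure B.
Proof.
rewrite 2!result_bind result_mapM => /mapP[g _ ->].
exact: box_measure_bounding_box_ge0.
Qed.

Lemma anchor_boxes_nonempty_data :
  0 < \sum_(B <- result (anchor_boxes F s X)) box_measure B ->
  (0 < size X)%N.
Proof.
rewrite lt0n size_eq0; apply: contraTneq => ->.
by rewrite 2!result_bind groups_nil big_nil ltxx.
Qed.

Lemma anchor_net_bounds m :
  0 < \sum_(B <- result (anchor_boxes F s X)) box_measure B ->
  (cost (anchor_net F s m X) <= cost (anchor_boxes F s X)
     + (2 * d + 4) * s + c_F * (d * (m + s)))%N /\
  (size (result (anchor_net F s m X)) <= m + s)%N.
Proof.
have [_] := anchor_boxes_bounds.
have := anchor_boxes_measure_ge0.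
rewrite /anchor_net; move: (anchor_boxes F s X) => Bs Bs_ge0 sizeBs total_gt0.
rewrite 4!cost_bind 4!result_bind.
set vols := mapM (@box_volume R d) (result Bs).
set total := foldM _ 0 _; set As := mapM _ _.
have volsE : result vols = [seq box_measure B | B <- result Bs].
  by rewrite result_mapM; apply: eq_map => B; apply: box_volumeE.
have totalE : result total = \sum_(v <- result vols) v.
  have acc b vs : foldl (fun b a : R => result (add_op b a)) b vs
      = b + \sum_(v <- vs) v.
    elim: vs b => [|v vs IHvs] b /=; first by rewrite big_nil addr0.
    by rewrite IHvs big_cons addrA.
  by rewrite result_foldM acc add0r.
have costV : (cost vols <= 2 * d * s)%N.
  rewrite cost_mapM.
  apply: (@leq_trans (\sum_(B <- result Bs) 2 * d)).
    by apply: leq_sum => B _; apply: cost_box_volume.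
  by rewrite big_const_seq count_predT iter_addn_0 leq_mul.
have costT : (cost total <= s)%N.
  apply: (@leq_trans (1 * size (result vols))); first exact: cost_foldM_le.
  by rewrite mul1n volsE size_map.
pose share v := `|Num.ceil (m%:R * v / result total)|%N.
have sum_share : (\sum_(v <- result vols) share v <= m + s)%N.
  rewrite /share totalE.
  apply: leq_trans (sum_ceil_share_le _ _ _) _.
  - by rewrite volsE; apply/allP => _ /mapP[B /Bs_ge0 ? ->].
  - by rewrite volsE big_map.
  - by rewrite volsE size_map leq_add2l.
set Z := zip _ _ in As *.
(* The three lists zipped together have the same length, so no volume is lost. *)
have sum_zip g : (\sum_(p <- Z) g p.2.2 = \sum_(v <- result vols) g v)%N.
  have <- : unzip2 (unzip2 Z) = result vols.
    rewrite unzip2_zip ?unzip2_zip // ?size_zip volsE ?size_map //.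
    by rewrite minnn size_iota.
  by rewrite !big_map.
have sizeA : size (result (ret (flatten (result As))))
    = (\sum_(v <- result vols) share v)%N.
  rewrite /= size_flatten sumnE big_map result_mapM big_map -sum_zip.
  by apply: eq_bigr => -[i [B v]] _; rewrite 3!result_bind size_rescaled_set.
have costA : (cost As <= 3 * s + c_F * (d * (m + s)))%N.
  rewrite cost_mapM.
  apply: (@leq_trans (\sum_(v <- result vols) (3 + c_F * (d * share v)))).
    rewrite -sum_zip; apply: leq_sum => -[i [B v]] _.
    exact: leq_add (leqnn 3) (F_cost i (share v) B).
  rewrite big_split /= big_const_seq count_predT iter_addn_0 volsE size_map -volsE.
  by rewrite leq_add ?leq_mul // -!big_distrr /= !leq_mul.
split; last by rewrite sizeA.
move: costV costT costA; rewrite [cost (ret _)]/=.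
by move: (cost vols) (cost total) (cost As) => cv ct ca; lia.
Qed.

Lemma cost_anchor_net_method m :
  (cost (anchor_net_method F s m X) <= cost (anchor_net F s m X)
     + (4 * d + 1) * size X * size (result (anchor_net F s m X)))%N.
Proof.
rewrite 2!cost_bind [cost (ret _)]/= addn0 leq_add2l.
by apply: cost_foldM_le => S y; rewrite cost_bind addn0 cost_nearest.
Qed.

End AnchorNet.

(** * The complexity bound *)

Theorem proposition4p6 (R : realType) (c_s c_F : nat) :
  exists C : nat,
    forall (d n m s : nat) (F : nat -> point_family R d)
           (X : n.-tuple (pt R d)),
      (0 < d)%N -> (0 < m)%N -> uniq X ->
      (0 < s <= c_s * m)%N ->
      (forall i, is_point_family (F i)) ->
      (forall i k B, (cost (rescaled_set (F i) k B) <= c_F * (d * k))%N) ->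
      0 < \sum_(B <- result (anchor_boxes F s X)) box_measure B ->
      (cost (anchor_net_method F s m X) <= C * (m * d * n))%N.
Proof.
(* With [M = m * d * n], the bounding boxes contribute [4 M]; the search in the
   initial set [5 c_s M]; the emptiness tests [c_s M]; the volumes, their sum and
   the shares [6 c_s M]; the generation of point sets [(2 c_F c_s + c_F) M]; the
   final search [(5 + 5 c_s) M]. *)
exists (9 + 17 * c_s + 2 * (c_F * c_s) + c_F)%N.
move=> d n m s F X d_gt0 m_gt0 _ /andP[s_gt0 s_le] F_family F_cost vol_gt0.
have := anchor_boxes_nonempty_data vol_gt0.
have := cost_anchor_net_method F s X m.
have [] := anchor_net_bounds F_family F_cost s_gt0 m vol_gt0.
have [] := anchor_boxes_bounds F_family F_cost X s_gt0.
rewrite size_tuple => costB _ costA sizeA costM n_gt0.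
set M := (m * d * n)%N.
have dn_le : (d * n <= M)%N by rewrite /M -mulnA leq_pmull.
have n_le : (n <= d * n)%N by rewrite leq_pmull.
have md_le : (d * m <= M)%N by rewrite /M mulnC leq_pmulr.
have dsn_le : (d * s * n <= c_s * M)%N.
  by rewrite /M !mulnA [(d * s)%N]mulnC !leq_mul.
have ds_le : (d * s <= d * s * n)%N by rewrite leq_pmulr.
have sn_le : (s * n <= d * s * n)%N by rewrite -mulnA leq_pmull.
have s_ds : (s <= d * s)%N by rewrite leq_pmull.
have mn_le : (m * n <= M)%N by rewrite /M leq_mul // leq_pmulr.
have cF_ds : (c_F * (d * s) <= c_F * (c_s * M))%N.
  by rewrite leq_mul // (leq_trans ds_le).
have cF_dm : (c_F * (d * m) <= c_F * M)%N by rewrite leq_mul.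
have last_le : ((4 * d + 1) * n * size (result (anchor_net F s m X))
    <= 4 * M + m * n + 4 * (d * s * n) + s * n)%N.
  by apply: leq_trans (leq_mul (leqnn _) sizeA) _; rewrite /M; lia.
move: costM costA costB; lia.
Qed.
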